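(* Let $0<p<1$, let $K\subseteq\mathbb{R}^n$ be a $p$-convex set with $0\in K$, and let $F=(f_1,\ldots,f_m):K\to\mathbb{R}^m_+$. If there exists $i_0\in\{1,\ldots,m\}$ such that $f_{i_0}$ is $p$-convex, then $0$ is a weakly efficient point of $F$ on $K$, that is, $0\in E_W(K)$.
   Context: For $0<p\le 1$, a set $K\subseteq\mathbb{R}^n$ is called $p$-convex if $\lambda x+\mu y\in K$ for every $x,y\in K$ and all $\lambda,\mu\ge 0$ with $\lambda^p+\mu^p=1$. A function $f:K\to\mathbb{R}$ is called $p$-convex if $K$ is a $p$-convex set and $f(\lambda x+\mu y)\le\lambda f(x)+\mu f(y)$ for all $x,y\in K$ and all $\lambda,\mu\ge 0$ with $\lambda^p+\mu^p=1$. $\mathbb{R}^m_+$ is the set of vectors in $\mathbb{R}^m$ with nonnegative coordinates ($m\ge 1$). A point $\bar x\in K$ is a weakly efficient point of $F$ on $K$ if $F(x)-F(\bar x)\in\mathbb{R}^m\setminus(-\mathrm{int}\,\mathbb{R}^m_+)$ for all $x\in K$, i.e. there is no $x\in K$ with $f_i(x)<f_i(\bar x)$ for all $i$. $E_W(K)$ denotes the set of weakly efficient points of $F$ on $K$. *)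

(* Defs.v *)
From mathcomp Require Import all_boot all_order all_algebra.
From mathcomp Require Import all_classical all_reals all_analysis.

Set Implicit Arguments.
Unset Strict Implicit.
Unset Printing Implicit Defensive.

Import Order.TTheory GRing.Theory Num.Theory.
Import numFieldNormedType.Exports.

Local Open Scope classical_set_scope.
Local Open Scope ring_scope.

(* Functions defined on a subset K of R^n are represented by total functions
   on 'rV[R]_n; every condition below only involves their values on K. *)

Definition pconvex_set (R : realType) (n : nat) (p : R) (K : set 'rV[R]_n) :=
  forall x y : 'rV[R]_n, K x -> K y ->
  forall lambda mu : R, 0 <= lambda -> 0 <= mu ->
    lambda `^ p + mu `^ p = 1 -> K (lambda *: x + mu *: y).

Definition pconvex_fun (R : realType) (n : nat) (p : R) (K : set 'rV[R]_n)
    (f : 'rV[R]_n -> R) :=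
  pconvex_set p K /\
  forall x y : 'rV[R]_n, K x -> K y ->
  forall lambda mu : R, 0 <= lambda -> 0 <= mu ->
    lambda `^ p + mu `^ p = 1 ->
    f (lambda *: x + mu *: y) <= lambda * f x + mu * f y.

Definition nonneg_orthant (R : realType) (m : nat) : set 'rV[R]_m :=
  [set v | forall i : 'I_m, 0 <= v 0 i].
Arguments nonneg_orthant : clear implicits.

Definition weakly_efficient (R : realType) (n m : nat)
    (F : 'rV[R]_n -> 'rV[R]_m) (K : set 'rV[R]_n) : set 'rV[R]_n :=
  [set xbar | K xbar /\
    forall x, K x ->
      (~` [set - v | v in (interior (nonneg_orthant R m) : set 'rV[R]_m)]) (F x - F xbar)].

(* Main.v *)
(* Taking lambda = mu = 2^(-1/p) gives lambda + mu < 1 because p < 1, so at the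
   origin p-convexity reads f 0 <= (lambda + mu) * f 0; hence a nonnegative
   p-convex f attains its minimum at 0, with value 0. *)

Require Import Defs.
From mathcomp Require Import all_boot all_order all_algebra.
From mathcomp Require Import all_classical all_reals all_analysis.
From mathcomp Require Import lra.

Set Implicit Arguments.
Unset Strict Implicit.
Unset Printing Implicit Defensive.

Import Order.TTheory GRing.Theory Num.Theory.
Import numFieldNormedType.Exports.

Local Open Scope classical_set_scope.
Local Open Scope ring_scope.

(** Compare logarithms: [ln 2^-1] is negative, so multiplying it by [p^-1 > 1] decreases it. *)
Lemma half_powR_inv_lt (R : realType) (p : R) : 0 < p -> p < 1 ->
  2^-1 `^ p^-1 < 2^-1.
Proof.
move=> p_gt0 p_lt1.
have half_gt0 : 0 < 2^-1 :> R by rewrite invr_gt0.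
rewrite -ltr_ln ?posrE ?powR_gt0 // ln_powR.
have ln_half_lt0 : ln 2^-1 < 0 :> R.
  by rewrite lnV ?posrE// oppr_lt0 ln_gt0// ltr1n.
by rewrite gtr_nMl// invf_gt1.
Qed.

Lemma pconvex_fun_ge0_at0 (R : realType) (n : nat) (p : R)
    (K : set 'rV[R]_n) (f : 'rV[R]_n -> R) :
  0 < p -> p < 1 -> K 0 -> 0 <= f 0 -> pconvex_fun p K f -> f 0 = 0.
Proof.
move=> p_gt0 p_lt1 K0 f0_ge0 [_ fconv].
pose a : R := 2^-1 `^ p^-1.
have a_half : a < 2^-1 by exact: half_powR_inv_lt.
have apE : a `^ p = 2^-1.
  by rewrite -powRrM mulVf ?gt_eqF// powRr1// invr_ge0.
have := fconv 0 0 K0 K0 a a (powR_ge0 _ _) (powR_ge0 _ _).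
rewrite apE !scaler0 addr0 => /(_ ltac:(lra)) f0_le.
apply/eqP; rewrite eq_le f0_ge0 andbT.
(* If [f 0 > 0], multiplying by [2^-1 - a > 0] gives [2 * a * f 0 < f 0], against [f0_le]. *)
nra.
Qed.

Lemma interior_nonneg_orthant_gt0 (R : realType) (m : nat) (v : 'rV[R]_m)
    (i : 'I_m) : (nonneg_orthant R m)° v -> 0 < v 0 i.
Proof.
move=> /nbhs_ballP[e /= e_gt0 ve].
(* Balls are entrywise, so lowering every coordinate by [e / 2] stays in the orthant, whence
   [v 0 i >= e / 2]. *)
have /ve/(_ i) : ball v e (v - const_mx (e / 2)).
  split=> // j k; rewrite /ball/= !mxE opprB addrC subrK gtr0_norm; lra.
rewrite !mxE; lra.
Qed.

Theorem corollary6p3 (R : realType) (n m : nat) (hm : (1 <= m)%N)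
    (p : R) (hp0 : 0 < p) (hp1 : p < 1)
    (K : set 'rV[R]_n) (hK : pconvex_set p K) (hK0 : K 0)
    (F : 'rV[R]_n -> 'rV[R]_m)
    (hF : forall x, K x -> nonneg_orthant R m (F x))
    (hconv : exists i0 : 'I_m, pconvex_fun p K (fun x => F x 0 i0)) :
  weakly_efficient F K 0.
Proof.
case: hconv => i0 f_conv; split=> // x Kx [v v_int vE].
have F00 : F 0 0 i0 = 0.
  exact: (pconvex_fun_ge0_at0 hp0 hp1 hK0 (hF 0 hK0 i0) f_conv).
(* At coordinate [i0], [vE] equates [- v 0 i0 < 0] with [F x 0 i0 >= 0], since [F 0] vanishes
   there. *)
have := interior_nonneg_orthant_gt0 i0 v_int.
have := hF x Kx i0.
have := congr1 (fun w : 'rV[R]_m => w 0 i0) vE.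
rewrite !mxE F00; lra.
Qed.
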